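(* Let $\mathbf{u}^0\in(L^2(\Omega))^3$ be a given initial field, let $\mathbf{u}_c\in\mathbf{E}(\Omega)$, and let $\lambda\in H^2(\Omega)$ satisfy $$\nabla\cdot(S^{-1}\nabla\lambda)=\nabla\cdot(\mathbf{u}_c-\mathbf{u}^0)\quad\text{in }\Omega,$$ together with one of the two boundary conditions $$(\mathbf{u}_c-\mathbf{u}^0-S^{-1}\nabla\lambda)\cdot\nu=0\ \text{ on }\Gamma,\qquad\text{or}\qquad\lambda=0\ \text{ on }\Gamma.$$ Put $\mathbf{p}=-(\mathbf{u}_c-\mathbf{u}^0-S^{-1}\nabla\lambda)$, assume $\mathbf{p}\neq0$, and let $f(t)=J(\mathbf{u}_c+t\mathbf{p})$ for $t\in\mathbb{R}$. Then $$f(t)=J(\mathbf{u}_c)-t\langle S\mathbf{p},\mathbf{p}\rangle_{\mathbf{L}^2(\Omega)}+\frac{t^2}{2}\langle S\mathbf{p},\mathbf{p}\rangle_{\mathbf{L}^2(\Omega)}\qquad(t\in\mathbb{R}),$$ so the unique minimizer of $f$ is $t_c=1$, and the adjusted field for $\mathbf{u}_c$ in the direction $\mathbf{p}$ is $$\mathbf{u}_+=\mathbf{u}^0+S^{-1}\nabla\lambda.$$ In particular, for $\mathbf{u}_c=0$ the adjusted field is Sasaki's solution, i.e. $\mathbf{u}_+=\mathbf{u}^0+S^{-1}\nabla\lambda$ with $\nabla\cdot(S^{-1}\nabla\lambda)=-\nabla\cdot\mathbf{u}^0$ in $\Omega$ and with $(\mathbf{u}^0+S^{-1}\nabla\lambda)\cdot\nu=0$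 or $\lambda=0$ on $\Gamma$.
   Context: $\Omega\subset\mathbb{R}^3$ is a bounded Lipschitz domain with boundary $\Gamma$ and outward unit normal $\nu$; functions are real valued and $\mathbf{L}^2(\Omega)=(L^2(\Omega))^3$ carries its standard inner product. $\mathbf{E}(\Omega)=\{\mathbf{u}\in(L^2(\Omega))^3:\nabla\cdot\mathbf{u}\in L^2(\Omega)\}$, with distributional divergence. For $\mathbf{h}\in\mathbf{E}(\Omega)$ the normal trace $\mathbf{h}\cdot\nu\in H^{-1/2}(\Gamma)$ is understood in the generalized sense, so that $\int_\Omega\lambda\,\nabla\cdot\mathbf{h}\,dx=\int_{\Gamma}\lambda\,\mathbf{h}\cdot\nu\,d\Gamma-\int_\Omega\nabla\lambda\cdot\mathbf{h}\,dx$ for all $\lambda\in H^1(\Omega)$, the boundary integral being the duality pairing of $H^{-1/2}(\Gamma)$ and $H^{1/2}(\Gamma)$. $S$ is a constant real symmetric positive definite $3\times3$ matrix, and $$J(\mathbf{u})=\frac12\int_\Omega S(\mathbf{u}-\mathbf{u}^0)\cdot(\mathbf{u}-\mathbf{u}^0)\,dx$$ (the observation operator being the identity, $\mathcal{M}(\mathbf{u})=\mathbf{u}$). The adjusted field for $\mathbf{u}_c$ in the direction $\mathbf{p}$ is $\mathbf{u}_+=\mathbf{u}_c+t_c\mathbf{p}$, where $t_c$ is the unique minimizer over $t\in\mathbb{R}$ of $t\mapsto J(\mathbf{u}_c+t\mathbf{p})$. *)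

(* Defs.v *)
From mathcomp Require Import all_boot all_order all_algebra.
From mathcomp Require Import all_classical all_reals all_analysis.
Set Implicit Arguments.
Unset Strict Implicit.
Unset Printing Implicit Defensive.
Import Order.TTheory GRing.Theory Num.Theory numFieldNormedType.Exports.
Local Open Scope classical_set_scope.
Local Open Scope ring_scope.

(* Points of R^3 are triples, so that Lebesgue measure is a product measure;
   values of vector fields are columns, on which 3 x 3 matrices act.
   Functions on Omega are total functions on R^3, of which only the restriction
   to Omega matters. *)
Notation R3 R := (R * R * R)%type.
Notation vfield R := (R * R * R -> 'cV[R]_3).

Section Euclidean.
Context {R : realType}.

Definition leb3 : {measure set
    (measurableTypeR R * measurableTypeR R * measurableTypeR R) -> \bar R} :=
  ((@lebesgue_measure R \x @lebesgue_measure R) \x @lebesgue_measure R)%E.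

Definition pt (v : 'cV[R]_3) : R3 R := (v 0 0, v 1 0, v 2%:R 0).

Definition vec (x : R3 R) : 'cV[R]_3 := \col_i [:: x.1.1; x.1.2; x.2]`_i.

Definition dot (u v : 'cV[R]_3) : R := \sum_i u i 0 * v i 0.

Definition mxapp (A : 'M[R]_3) (h : vfield R) : vfield R := fun x => A *m h x.

Definition sym_posdef (S : 'M[R]_3) : Prop :=
  S^T = S /\ forall v : 'cV[R]_3, v != 0 -> 0 < dot (S *m v) v.

(* Near each boundary point, in suitable Cartesian coordinates z = Q y with Q
   orthogonal, Omega lies strictly above the graph of a Lipschitz function. *)
Definition lipschitz_boundary (Omega : set (R3 R)) : Prop :=
  forall x, (closure Omega `\` interior Omega) x ->
  exists (V : set (R3 R)) (Q : 'M[R]_3) (gamma : R * R -> R) (k : R),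
    [/\ nbhs x V, Q^T *m Q = 1%:M, k.-lipschitz gamma &
        forall y, V y ->
          let z := pt (Q *m vec y) in Omega y <-> gamma z.1 < z.2].

Definition bounded_lipschitz_domain (Omega : set (R3 R)) : Prop :=
  [/\ Omega !=set0, open Omega, connected Omega, bounded_set Omega &
      lipschitz_boundary Omega].

End Euclidean.

Section Sobolev.
Context {R : realType} (Omega : set (R3 R)).
Local Notation mu := (@leb3 R).
Implicit Types (u phi lam : R3 R -> R) (h G : vfield R).

Definition partial (i : 'I_3) phi : R3 R -> R :=
  fun x => 'D_(pt (delta_mx i 0)) phi x.

Definition grad phi : vfield R := fun x => \col_i partial i phi x.

Definition smooth phi : Prop := forall s : seq 'I_3,
  continuous (foldr partial phi s) /\
  forall x i, derivable (foldr partial phi s) x (pt (delta_mx i 0)).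

(* C_c^oo(Omega) *)
Definition test_function phi : Prop :=
  [/\ smooth phi, compact (closure [set x | phi x != 0]) &
      closure [set x | phi x != 0] `<=` Omega].

(* f \_ Omega is the extension of f by zero. *)
Definition L2 u : Prop := u \_ Omega \in Lfun mu 2%:E.

Definition L2v h : Prop := forall i, L2 (fun x => h x i 0).

(* inner product of L^2(Omega)^3 *)
Definition ip h G : R := \int[mu]_(x in Omega) dot (h x) (G x).

(* equality in L^2(Omega)^3 *)
Definition ae_eqv h G : Prop := {ae mu, forall x, Omega x -> h x = G x}.

Definition is_wgrad u G : Prop := L2v G /\
  forall phi i, test_function phi ->
    \int[mu]_(x in Omega) (u x * partial i phi x) =
    - \int[mu]_(x in Omega) (G x i 0 * phi x).

(* Weak gradient; unique up to a null set, and meaningful for u in H^1. *)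
Definition wgrad u : vfield R := xget 0 [set G | is_wgrad u G].

Definition H1 u : Prop := L2 u /\ exists G, is_wgrad u G.

Definition H2 u : Prop := H1 u /\ forall i, H1 (fun x => wgrad u x i 0).

(* H^1_0(Omega), the closure of C_c^oo(Omega) in H^1(Omega) *)
Definition H10 u : Prop := H1 u /\
  forall e : R, 0 < e -> exists2 phi, test_function phi &
    \int[mu]_(x in Omega) ((u x - phi x) ^+ 2) +
    ip (wgrad u - grad phi) (wgrad u - grad phi) < e.

(* The divergence of h as a distribution on Omega. *)
Definition distdiv h phi : R := - ip h (grad phi).

Definition is_wdiv h (g : R3 R -> R) : Prop := L2 g /\
  forall phi, test_function phi ->
    distdiv h phi = \int[mu]_(x in Omega) (g x * phi x).

Definition Ediv h : Prop := L2v h /\ exists g, is_wdiv h g.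

(* Traces: H^{1/2}(Gamma) is the trace space of H^1(Omega), i.e. the quotient
   H^1(Omega) / H^1_0(Omega), and lam = 0 on Gamma means that lam has the zero
   trace. H^{-1/2}(Gamma) is the dual of the trace space; for g = div h,
   normal_trace h g lam is the pairing of h . nu with the trace of lam, given
   by Green's formula (g is determined by h up to a null set). *)
Definition zero_trace lam : Prop := H10 lam.

Definition normal_trace h (g : R3 R -> R) lam : R :=
  \int[mu]_(x in Omega) (lam x * g x) + ip (wgrad lam) h.

Definition zero_normal_trace h : Prop := Ediv h /\
  forall g lam, is_wdiv h g -> H1 lam -> normal_trace h g lam = 0.

End Sobolev.

Variant bc_kind := NormalBC | DirichletBC.

(* h . nu = 0 on Gamma, respectively lam = 0 on Gamma *)
Definition boundary_condition {R : realType} (b : bc_kind)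
    (Omega : set (R3 R)) (h : vfield R) (lam : R3 R -> R) : Prop :=
  match b with
  | NormalBC => zero_normal_trace Omega h
  | DirichletBC => zero_trace Omega lam
  end.

Section Adjustment.
Context {R : realType}.

Definition J (Omega : set (R3 R)) (S : 'M[R]_3) (u0 u : vfield R) : R :=
  2^-1 * ip Omega (mxapp S (u - u0)) (u - u0).

Definition minimizer (f : R -> R) (t : R) : Prop := forall s, f t <= f s.

Definition unique_minimizer (f : R -> R) (t : R) : Prop :=
  minimizer f t /\ forall s, minimizer f s -> s = t.

Definition step_length (Omega : set (R3 R)) (S : 'M[R]_3)
    (u0 uc p : vfield R) : R :=
  xget 0 [set t | unique_minimizer (fun t => J Omega S u0 (uc + t *: p)) t].

Definition adjusted_field (Omega : set (R3 R)) (S : 'M[R]_3)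
    (u0 uc p : vfield R) : vfield R :=
  uc + step_length Omega S u0 uc p *: p.

End Adjustment.

(* Main.v *)
Require Import Defs.
From mathcomp Require Import all_boot all_order all_algebra.
From mathcomp Require Import all_classical all_reals all_analysis.
From mathcomp Require Import measurable_realfun.
From mathcomp Require Import ring lra.
Import Order.TTheory GRing.Theory Num.Theory numFieldNormedType.Exports.
Local Open Scope classical_set_scope.
Local Open Scope ring_scope.

(** Put w = uc - u0 and q = S^-1 grad lam, so that p = q - w. Since J is
    quadratic, f(t) = J(uc) + t <S w, p> + t^2/2 <S p, p> (lemma [J_line]), and
    S w = grad lam - S p. The formula for f therefore amounts to the
    orthogonality <grad lam, p> = 0 (lemma [wgrad_orthogonal]). The equation for
    lam says that p is divergence free. Under the Neumann condition p also has
    zero normal trace, and orthogonality is Green's formula for p tested against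
    lam. Under the Dirichlet condition p is orthogonal to the gradients of test
    functions, and grad lam is a limit of such gradients in L^2.

    As S is positive definite and p is not zero almost everywhere, <S p, p> is
    positive (lemma [ip_posdef_gt0]); the parabola f then has its unique minimum
    at t = 1, and uc + p = u0 + q. When uc = 0 almost everywhere, u0 + q is
    almost everywhere the opposite of w - q, so it inherits the boundary
    condition (lemma [zero_normal_trace_ae_opp]).

    These computations with inner products require the integrals to converge.
    For gradients of test functions this rests on two facts about the product
    measure on R^3: continuous functions are measurable (lemma
    [continuous_measurable3]) and bounded sets have finite measure (lemma
    [bounded_leb3_lty]). *)

(** R^3 with the product sigma-algebra on which [leb3] is defined. *)
Local Notation M3 R :=
  (measurableTypeR R * measurableTypeR R * measurableTypeR R)%type.

(** * Lebesgue measure and the topology of R^3 *)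

Definition box {R : realType} (I : interval R * interval R * interval R) :
  set (R3 R) := ([set` I.1.1] `*` [set` I.1.2]) `*` [set` I.2].

Lemma measurable_box (R : realType) (I : interval R * interval R * interval R) :
  measurable (box I : set (M3 R)).
Proof. by do 2?apply: measurableX; exact: measurable_itv. Qed.

Definition rat_itv (R : realType) (ab : rat * rat) : interval R :=
  `]ratr ab.1, ratr ab.2[.

Definition rat_box (R : realType)
    (q : (rat * rat) * (rat * rat) * (rat * rat)) : set (R3 R) :=
  box (rat_itv R q.1.1, rat_itv R q.1.2, rat_itv R q.2).

Lemma rat_itv_near {R : realType} (x e : R) : 0 < e ->
  exists2 ab : rat * rat, x \in rat_itv R ab &
    {in rat_itv R ab, forall y, `|x - y| < e}.
Proof.
move=> e0.
have [a] : exists q : rat, ratr q \in `]x - e, x[ by apply: rat_in_itvoo; lra.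
have [b] : exists q : rat, ratr q \in `]x, x + e[ by apply: rat_in_itvoo; lra.
rewrite !in_itv/= => /andP[xb be] /andP[ea ax].
exists (a, b) => /=; first by rewrite in_itv/= ax xb.
by move=> y; rewrite in_itv/= => /andP[ay yb]; rewrite ltr_norml; lra.
Qed.

(** An open set is the union of the boxes with rational endpoints that it
    contains, and there are countably many of them. *)
Lemma open_measurable3 (R : realType) (U : set (R3 R)) : open U ->
  measurable (U : set (M3 R)).
Proof.
move=> oU.
have -> : U = \bigcup_q (if `[< @rat_box R q `<=` U >] then rat_box R q
                        else set0).
  apply/seteqP; split=> [x Ux|x [q _]];
    last by case: asboolP => // qU; exact: qU.
  have /nbhs_ballP : nbhs x U by rewrite nbhsE; exists U.
  move=> [e /= e0 xeU].
  have [I1 x1 I1e] := rat_itv_near x.1.1 _ e0.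
  have [I2 x2 I2e] := rat_itv_near x.1.2 _ e0.
  have [I3 x3 I3e] := rat_itv_near x.2 _ e0.
  exists (I1, I2, I3) => //; case: asboolP => [_|[]]; first by split.
  move=> y [[y1 y2] y3]; apply: xeU.
  by split; [split|]; [exact: I1e|exact: I2e|exact: I3e].
apply: countable_bigcupT_measurable => // q; case: asboolP => // _.
exact: measurable_box.
Qed.

Lemma continuous_measurable3 (R : realType) (f : R3 R -> R) : continuous f ->
  measurable_fun setT (f : M3 R -> R).
Proof.
move=> /continuousP cf; apply: (measurability _ (RGenOInfty.measurableE R)).
move=> _ [_ [a ->] <-]; rewrite setTI.
by apply: (open_measurable3 R (f @^-1` `]a, +oo[)); apply: cf;
   exact: interval_open.
Qed.

Lemma bounded_leb3_lty (R : realType) (A : set (R3 R)) : bounded_set A ->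
  measurable (A : set (M3 R)) -> (leb3 A < +oo)%E.
Proof.
move=> [M0 [_ /(_ (`|M0| + 1))]] bA mA.
set M := `|M0| + 1 in bA.
have {}bA : {in A, forall x, `|x| <= M}.
  by move=> x /set_mem; apply: bA; rewrite /M (le_lt_trans (ler_norm _))// ltrDl.
have M0' : - M < M by rewrite /M; have := normr_ge0 M0; lra.
pose I := `[- M, M].
have AI : A `<=` box (I, I, I).
  move=> x /mem_set/bA; rewrite prod_normE/= ge_max => /andP[].
  rewrite prod_normE/= ge_max => /andP[x1 x2 x3].
  by split; [split|]; rewrite /= /I in_itv/= -ler_norml.
apply: (@le_lt_trans _ _ (leb3 (box (I, I, I)))).
  by apply: le_measure => //; rewrite ?inE//; exact: measurable_box.
have mI : measurable ([set` I] : set (measurableTypeR R)) by exact: measurable_itv.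
have -> : leb3 (box (I, I, I)) =
    (lebesgue_measure [set` I] * lebesgue_measure [set` I] *
     lebesgue_measure [set` I])%E.
  rewrite -product_measure1E//.
  by apply: product_measure1E => //; exact: measurableX.
by rewrite /= lebesgue_measure_itv/= lte_fin M0' -!EFinD -!EFinM ltry.
Qed.

(** * The Euclidean inner product *)

Section Dot.
Context {R : realType}.
Implicit Types (u v w : 'cV[R]_3) (S : 'M[R]_3).

Lemma dotC u v : dot u v = dot v u.
Proof. by apply: eq_bigr => i _; rewrite mulrC. Qed.

Lemma dotDl u v w : dot (u + v) w = dot u w + dot v w.
Proof. by rewrite -big_split; apply: eq_bigr => i _; rewrite mxE mulrDl. Qed.

Lemma dotZl a u v : dot (a *: u) v = a * dot u v.
Proof. by rewrite mulr_sumr; apply: eq_bigr => i _; rewrite mxE mulrA. Qed.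

Lemma dot_mulmx u v : dot u v = (u^T *m v) 0 0.
Proof. by rewrite mxE; apply: eq_bigr => i _; rewrite mxE. Qed.

Lemma dot_symmx S u v : S^T = S -> dot (S *m u) v = dot u (S *m v).
Proof. by move=> SS; rewrite !dot_mulmx trmx_mul SS mulmxA. Qed.

Lemma dot_posdef_ge0 S u : sym_posdef S -> 0 <= dot (S *m u) u.
Proof.
move=> [_ S0]; have [->|/S0/ltW//] := eqVneq u 0.
by rewrite mulmx0 /dot big1// => i _; rewrite mxE mul0r.
Qed.

Lemma posdef_unitmx S : sym_posdef S -> S \in unitmx.
Proof.
move=> [SS S0]; rewrite unitmxE unitfE; apply/negP => /det0P[v v0 vS].
have := S0 v^T; rewrite trmx_eq0 => /(_ v0).
by rewrite -{1}SS -trmx_mul vS trmx0 dotC dot_mulmx mulmx0 mxE ltxx.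
Qed.

End Dot.

(** * The space L^2 and its inner product *)

Section L2theory.
Context {R : realType} (Omega : set (R3 R)).
Hypothesis mOmega : measurable (Omega : set (M3 R)).
Local Notation mu := (@leb3 R).
Implicit Types (u w : R3 R -> R) (h G : vfield R) (a : R).

Lemma L2_0 : L2 Omega (fun=> 0).
Proof.
rewrite /L2 (_ : _ \_ _ = 0); first exact: (Lfun_addr_closed mu (lee1n 2)).1.
by apply/funext => x; rewrite patchE; case: ifP.
Qed.

Lemma L2D u w : L2 Omega u -> L2 Omega w -> L2 Omega (fun x => u x + w x).
Proof.
rewrite /L2 => Lu Lw.
rewrite (_ : _ \_ _ = (u \_ Omega : M3 R -> R) + w \_ Omega).
  exact: (Lfun_addr_closed mu (lee1n 2)).2.
by apply/funext => x; rewrite [RHS]/GRing.add/= !patchE;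
  case: ifP => // _; rewrite addr0.
Qed.

Lemma L2Z a u : L2 Omega u -> L2 Omega (fun x => a * u x).
Proof.
rewrite /L2 => Lu.
rewrite (_ : _ \_ _ = a \o* (u \_ Omega : M3 R -> R)).
  apply: Lfun_scale => //; exact: ler1n.
by apply/funext => x /=; rewrite !patchE; case: ifP => // _;
  rewrite ?mul0r// mulrC.
Qed.

Lemma L2_bounded u (M : R) : (mu Omega < +oo)%E ->
  measurable_fun setT (u : M3 R -> R) -> (forall x, `|u x| <= M) -> L2 Omega u.
Proof.
move=> fOmega mfu uM.
have mu' : measurable_fun setT (u \_ Omega : M3 R -> R).
  by apply/(measurable_restrictT u mOmega); exact: measurable_funS mfu.
rewrite /L2 inE; apply/andP; split; rewrite inE//= /finite_norm.
rewrite unlock poweR_lty//.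
apply: (@le_lt_trans _ _ (\int[mu]_x ((cst (M `^ 2)%:E) \_ Omega) x)%E).
  apply: ge0_le_integral => //=.
  - apply/measurable_EFinP/(measurableT_comp (measurable_powR _)) => //.
    exact: measurableT_comp.
  - by apply/(measurable_restrictT _ mOmega); exact: measurable_cst.
  - move=> x _; rewrite !patchE; case: ifP => _.
      by rewrite lee_fin ge0_ler_powR ?nnegrE//; exact: le_trans (uM x).
    by rewrite normr0 powR0.
by rewrite -integral_mkcond integral_cst// lte_mul_pinfty// lee_fin powR_ge0.
Qed.

Lemma L2_integrableM u w : L2 Omega u -> L2 Omega w ->
  mu.-integrable Omega (EFin \o (fun x => u x * w x)).
Proof.
move=> Lu Lw; apply/(integrable_mkcond _ mOmega).
have /Lfun1_integrable := Lfun2_mul_Lfun1 Lu Lw.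
congr integrable; apply/funext => x /=; rewrite !patchE.
by case: ifP => // _; rewrite mulr0.
Qed.

Lemma L2vD h G : L2v Omega h -> L2v Omega G -> L2v Omega (h + G).
Proof. by move=> Lh LG i; under eq_fun do rewrite mxE; exact: L2D. Qed.

Lemma L2vZ a h : L2v Omega h -> L2v Omega (a *: h).
Proof. by move=> Lh i; under eq_fun do rewrite mxE; exact: L2Z. Qed.

Lemma L2vN h : L2v Omega h -> L2v Omega (- h).
Proof. by move=> Lh; rewrite -scaleN1r; exact: L2vZ. Qed.

Lemma L2vB h G : L2v Omega h -> L2v Omega G -> L2v Omega (h - G).
Proof. by move=> Lh LG; apply: L2vD => //; exact: L2vN. Qed.

Lemma L2v_mxapp (A : 'M[R]_3) h : L2v Omega h -> L2v Omega (mxapp A h).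
Proof.
move=> Lh i; under eq_fun do rewrite mxE.
elim: (index_enum _) => [|j s IHs].
  by under eq_fun do rewrite big_nil; exact: L2_0.
by under eq_fun do rewrite big_cons; apply: L2D => //; exact: L2Z.
Qed.

Lemma integrable_dot h G : L2v Omega h -> L2v Omega G ->
  mu.-integrable Omega (EFin \o (fun x => dot (h x) (G x))).
Proof.
move=> Lh LG; rewrite (_ : _ \o _ =
    fun x => (\sum_i (h x i 0 * G x i 0)%:E)%E).
  by apply: integrable_sum => // i _; exact: L2_integrableM.
by apply/funext => x /=; rewrite sumEFin.
Qed.

Lemma ipC h G : ip Omega h G = ip Omega G h.
Proof. by apply: eq_Rintegral => x _; rewrite dotC. Qed.

Lemma ipDl h1 h2 G : L2v Omega h1 -> L2v Omega h2 -> L2v Omega G ->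
  ip Omega (h1 + h2) G = ip Omega h1 G + ip Omega h2 G.
Proof.
move=> L1 L2 LG; rewrite -RintegralD//; try exact: integrable_dot.
by apply: eq_Rintegral => x _; rewrite dotDl.
Qed.

Lemma ipZl a h G : L2v Omega h -> L2v Omega G ->
  ip Omega (a *: h) G = a * ip Omega h G.
Proof.
move=> Lh LG; rewrite -RintegralZl//; last exact: integrable_dot.
by apply: eq_Rintegral => x _; rewrite dotZl.
Qed.

Lemma ip_mxappC (S : 'M[R]_3) h G : S^T = S ->
  ip Omega (mxapp S h) G = ip Omega h (mxapp S G).
Proof. by move=> SS; apply: eq_Rintegral => x _; exact: dot_symmx. Qed.

Lemma ip_ge0 h : 0 <= ip Omega h h.
Proof.
by apply: Rintegral_ge0 => x _; apply: sumr_ge0 => i _; rewrite -expr2 sqr_ge0.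
Qed.

Lemma ipDr h G1 G2 : L2v Omega h -> L2v Omega G1 -> L2v Omega G2 ->
  ip Omega h (G1 + G2) = ip Omega h G1 + ip Omega h G2.
Proof. by move=> *; rewrite ipC ipDl// !(ipC h). Qed.

Lemma ipZr a h G : L2v Omega h -> L2v Omega G ->
  ip Omega h (a *: G) = a * ip Omega h G.
Proof. by move=> *; rewrite ipC ipZl// ipC. Qed.

Lemma ipNl h G : L2v Omega h -> L2v Omega G -> ip Omega (- h) G = - ip Omega h G.
Proof. by move=> *; rewrite -scaleN1r ipZl// mulN1r. Qed.

(** Since a^2 = <G, h>^2 <= <G, G> <h, h> by Cauchy-Schwarz, a vanishes as soon
    as <G, G> can be made arbitrarily small. *)
Lemma ip_small_eq0 h a : L2v Omega h ->
  (forall e, 0 < e -> exists G, [/\ L2v Omega G, ip Omega G G < e &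
    ip Omega G h = a]) ->
  a = 0.
Proof.
move=> Lh small; apply: contrapT => /eqP a0.
set N := ip Omega h h; have N0 : 0 <= N by exact: ip_ge0.
have a2 : 0 < a ^+ 2 by rewrite exprn_even_gt0.
have /small[G [LG Ge Ga]] : 0 < a ^+ 2 / (N + 1) by rewrite divr_gt0//; lra.
(* The minimizer over s of <G + s h, G + s h> is - a / N; the denominator N + 1
   serves the same purpose and covers the case N = 0. *)
pose s := - a / (N + 1).
have := ip_ge0 (G + s *: h).
have Ls := L2vZ s _ Lh.
have LGs := L2vD _ _ LG Ls.
rewrite ipDl// !ipDr// !ipZl// !ipZr// (ipC h G) Ga -/N.
suff : ip Omega G G + s * a + (s * a + s * (s * N)) < 0 by lra.
have -> : s * a = - (a ^+ 2 / (N + 1)) by rewrite /s; ring.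
have -> : s * (s * N) = a ^+ 2 / (N + 1) * (N / (N + 1)).
  by rewrite /s; field; lra.
have : a ^+ 2 / (N + 1) * (N / (N + 1)) <= a ^+ 2 / (N + 1).
  by rewrite ger_pMr ?divr_gt0// ?ler_pdivrMr; lra.
by move: Ge; set q := a ^+ 2 / (N + 1); lra.
Qed.

Lemma ip_ae0 h G : L2v Omega h -> L2v Omega G -> ae_eqv Omega h 0 ->
  ip Omega h G = 0.
Proof.
move=> Lh LG h0; rewrite /ip /Rintegral (ae_eq_integral (cst 0%E))//.
- by rewrite integral0.
- exact: (measurable_int mu (integrable_dot _ _ Lh LG)).
- have := h0; apply: (@filterS _ _ (ae_filter_ringOfSetsType mu)).
  move=> x + Ox => /(_ Ox) /= ->.
  by rewrite /dot big1// => i _; rewrite mxE mul0r.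
Qed.

(** A nonnegative integrand with zero integral vanishes almost everywhere, and
    S v . v = 0 forces v = 0. *)
Lemma ip_posdef_gt0 (S : 'M[R]_3) h : sym_posdef S -> L2v Omega h ->
  ~ ae_eqv Omega h 0 -> 0 < ip Omega (mxapp S h) h.
Proof.
move=> posS Lh h0; rewrite lt_neqAle eq_sym; apply/andP; split; last first.
  by apply: Rintegral_ge0 => x _; exact: dot_posdef_ge0.
apply: contra_not_neq h0 => ip0.
have iS := integrable_dot _ _ (L2v_mxapp S _ Lh) Lh.
have : (\int[mu]_(x in Omega) `|(dot (S *m h x) (h x))%:E| = 0)%E.
  under eq_integral do rewrite gee0_abs ?lee_fin ?dot_posdef_ge0//.
  by rewrite -[LHS]fineK ?[fine _]ip0//; exact: integrable_fin_num.
move/(ae_eq_integral_abs mu mOmega (measurable_int mu iS)).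
apply: (@filterS _ _ (ae_filter_ringOfSetsType mu)) => x + Ox => /(_ Ox) [] Sh0.
apply: contrapT => /eqP hx0; have := posS.2 _ hx0.
by rewrite Sh0 ltxx.
Qed.

End L2theory.

(** * Test functions, weak gradients and traces *)

Section TestFunctions.
Context {R : realType} (Omega : set (R3 R)).
Hypotheses (oOmega : open Omega) (bOmega : bounded_set Omega).
Let mOmega : measurable (Omega : set (M3 R)) := open_measurable3 R Omega oOmega.
Local Notation mu := (@leb3 R).
Implicit Types (u phi : R3 R -> R) (h G : vfield R).

Lemma L2_continuous_compact_supp (K : set (R3 R)) u : compact K ->
  continuous u -> (forall x, ~ K x -> u x = 0) -> L2 Omega u.
Proof.
move=> cK cu uK.
have : compact (u @` K).
  by apply: continuous_compact => //; exact: continuous_subspaceT.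
move=> /compact_bounded[M [_ /(_ (`|M| + 1))]] uM.
apply: (L2_bounded Omega mOmega u (`|M| + 1)).
- exact: bounded_leb3_lty.
- exact: continuous_measurable3.
- move=> x; have [Kx|/uK ->] := pselect (K x); last by rewrite normr0 addr_ge0.
  by apply: uM; [rewrite (le_lt_trans (ler_norm _))// ltrDl|exists x].
Qed.

Lemma L2_test phi : test_function Omega phi -> L2 Omega phi.
Proof.
move=> [sphi cK _]; apply: (L2_continuous_compact_supp _ _ cK (sphi [::]).1).
move=> x nKx; apply: contrapT => /eqP phix; apply: nKx.
exact: subset_closure.
Qed.

Lemma L2v_grad phi : test_function Omega phi -> L2v Omega (grad phi).
Proof.
move=> [sphi cK _] i; under eq_fun do rewrite mxE.
apply: (L2_continuous_compact_supp _ _ cK (sphi [:: i]).1) => x nKx /=.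
(* Near x, phi vanishes, hence so does its partial derivative at x. *)
rewrite /partial (@near_eq_derive _ _ _ phi (cst 0)); first exact: derive_cst.
have : nbhs x (~` closure [set x | phi x != 0]).
  by apply: open_nbhs_nbhs; split => //; exact/closed_openC/closed_closure.
apply: filterS => y nKy; apply: contrapT => /eqP phiy; apply: nKy.
exact: subset_closure.
Qed.

Lemma distdivB h G phi :
  L2v Omega h -> L2v Omega G -> test_function Omega phi ->
  distdiv Omega (h - G) phi = distdiv Omega h phi - distdiv Omega G phi.
Proof.
move=> Lh LG tphi; have Lphi := L2v_grad _ tphi.
by rewrite /distdiv ipDl//; [rewrite ipNl//; ring|exact: L2vN].
Qed.

Lemma wgradP u : H1 Omega u -> is_wgrad Omega u (wgrad Omega u).
Proof.
move=> [_ [G uG]].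
by apply: (@xgetPex _ 0 [set G | is_wgrad Omega u G]); exists G.
Qed.

Lemma L2v_wgrad u : H1 Omega u -> L2v Omega (wgrad Omega u).
Proof. by move=> /wgradP[]. Qed.

(** Both boundary conditions kill the boundary term in
    <grad lam, h> = - <lam, div h> + (pairing of h . nu with the trace of lam). *)
Lemma wgrad_orthogonal b h lam : H1 Omega lam -> L2v Omega h ->
  (forall phi, test_function Omega phi -> distdiv Omega h phi = 0) ->
  boundary_condition b Omega h lam -> ip Omega (wgrad Omega lam) h = 0.
Proof.
move=> Hlam Lh div0; have Llam := L2v_wgrad _ Hlam.
case: b => /= [[_ /(_ (fun=> 0) lam)]|[_ dense]].
  (* The weak divergence of h is zero, so the pairing of h . nu with the trace
     of lam reduces to <grad lam, h>. *)
  rewrite /normal_trace; under eq_Rintegral do rewrite mulr0.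
  rewrite /Rintegral integral0 /= add0r; apply => //.
  split; first exact: L2_0.
  move=> phi /div0 ->; under eq_Rintegral do rewrite mul0r.
  by rewrite /Rintegral integral0.
(* With phi a test function close to lam, grad lam - grad phi is small in L^2 and
   has the same inner product with h as grad lam. *)
apply: (ip_small_eq0 Omega mOmega h _ Lh) => e /dense[phi tphi lamphi].
have Lphi := L2v_grad _ tphi.
exists (wgrad Omega lam - grad phi); split; first exact: L2vB.
- apply: le_lt_trans lamphi; rewrite lerDr.
  by apply: Rintegral_ge0 => x _; exact: sqr_ge0.
- have LN := L2vN _ _ Lphi.
  rewrite ipDl// ipNl// (ipC _ (grad phi)).
  have /eqP := div0 _ tphi; rewrite oppr_eq0 => /eqP ->.
  by rewrite subr0.
Qed.

Lemma Rintegral_mulNr u w : L2 Omega u -> L2 Omega w ->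
  \int[mu]_(x in Omega) (u x * (- w) x) = - \int[mu]_(x in Omega) (u x * w x).
Proof.
move=> Lu Lw; rewrite -[RHS]mulN1r -RintegralZl//; last exact: L2_integrableM.
by apply: eq_Rintegral => x _; rewrite mulN1r -mulrN.
Qed.

Lemma L2N u : L2 Omega u -> L2 Omega (- u).
Proof.
move=> Lu; rewrite (_ : - u = fun x => - 1 * u x); first exact: L2Z.
by apply/funext => x; rewrite mulN1r.
Qed.

(** G is almost everywhere the opposite of h, so its weak divergence and its
    normal trace are the opposites of those of h. *)
Lemma zero_normal_trace_ae_opp h G : L2v Omega G -> ae_eqv Omega (h + G) 0 ->
  zero_normal_trace Omega h -> zero_normal_trace Omega G.
Proof.
move=> LG hG0 [[Lh [g hg]] h0].
have ipG v : L2v Omega v -> ip Omega G v = - ip Omega h v.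
  move=> Lv; have := ip_ae0 _ mOmega _ _ (L2vD _ _ _ Lh LG) Lv hG0.
  by rewrite ipDl// => /eqP; rewrite addrC addr_eq0 => /eqP.
have wdivN h1 h2 k : (forall phi, test_function Omega phi ->
    distdiv Omega h2 phi = - distdiv Omega h1 phi) ->
    is_wdiv Omega h1 k -> is_wdiv Omega h2 (- k).
  move=> h12 [Lk hk]; split; first exact: L2N.
  move=> phi tphi; rewrite h12// hk//.
  have := Rintegral_mulNr _ _ (L2_test _ tphi) Lk.
  by under eq_Rintegral do rewrite mulrC;
  under [in RHS]eq_Rintegral do rewrite mulrC.
have divG phi : test_function Omega phi ->
    distdiv Omega G phi = - distdiv Omega h phi.
  by move=> tphi; rewrite /distdiv ipG//; exact: L2v_grad.
split; first by split => //; exists (- g); exact: wdivN hg.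
move=> k lam Gk Hlam.
have hk : is_wdiv Omega h (- k).
  by apply: wdivN Gk => phi tphi; rewrite divG// opprK.
have := h0 _ _ hk Hlam; rewrite /normal_trace Rintegral_mulNr//; last 2 first.
- exact: Hlam.1.
- exact: Gk.1.
rewrite 2!(ipC _ (wgrad Omega lam)) ipG; last exact: L2v_wgrad.
by move=> /eqP; rewrite addrC subr_eq0 => /eqP ->; rewrite subrr.
Qed.

End TestFunctions.

(** * The quadratic functional along a line *)

(** Completing the square, f(t) = c - k / 2 + k / 2 * (t - 1)^2. *)
Lemma quadratic_unique_minimizer {R : realType} (c k : R) (f : R -> R) :
  0 < k -> (forall t, f t = c - t * k + t ^+ 2 / 2 * k) ->
  unique_minimizer f 1.
Proof.
move=> k0 fE.
have fB s : f s - f 1 = k / 2 * (s - 1) ^+ 2 by rewrite !fE; field.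
split=> [s|s /(_ 1)].
  by rewrite -subr_ge0 fB mulr_ge0 ?sqr_ge0// divr_ge0// ltW.
rewrite -subr_le0 fB pmulr_rle0 ?divr_gt0// => s1; apply/eqP.
by rewrite -subr_eq0 -sqrf_eq0 eq_le s1 sqr_ge0.
Qed.

Lemma J_line {R : realType} (Omega : set (R3 R)) (S : 'M[R]_3)
    (u0 u p : vfield R) (t : R) : measurable (Omega : set (M3 R)) -> S^T = S ->
  L2v Omega (u - u0) -> L2v Omega p ->
  J Omega S u0 (u + t *: p) = J Omega S u0 u +
    t * ip Omega (mxapp S (u - u0)) p +
    t ^+ 2 / 2 * ip Omega (mxapp S p) p.
Proof.
rewrite /J (_ : u + t *: p - u0 = (u - u0) + t *: p); last by rewrite addrAC.
move: (u - u0) => w mO SS Lw Lp.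
have tp : L2v Omega (t *: p) by exact: L2vZ.
have [LSw LSp] : L2v Omega (mxapp S w) /\ L2v Omega (mxapp S p).
  by split; exact: L2v_mxapp.
have tSp : L2v Omega (t *: mxapp S p) by exact: L2vZ.
have wtp : L2v Omega (w + t *: p) by exact: L2vD.
rewrite (_ : mxapp S (w + t *: p) = mxapp S w + t *: mxapp S p); last first.
  apply/funext => x; transitivity (S *m (w x + t *: p x)) => //.
  by rewrite mulmxDr -scalemxAr.
rewrite ipDl// !ipDr//.
rewrite !ipZl// !ipZr//.
have -> : ip Omega (mxapp S p) w = ip Omega (mxapp S w) p.
  by rewrite ip_mxappC// ipC.
by field.
Qed.

(** * The adjusted field *)

Theorem mainTheorem3 (R : realType) (Omega : set (R3 R)) (S : 'M[R]_3)
    (u0 uc p : vfield R) (lam : R3 R -> R) (b : bc_kind)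
    (hOmega : bounded_lipschitz_domain Omega)
    (hS : sym_posdef S)
    (hu0 : L2v Omega u0)
    (huc : Ediv Omega uc)
    (hlam : H2 Omega lam)
    (heq : forall phi, test_function Omega phi ->
       distdiv Omega (mxapp (invmx S) (wgrad Omega lam)) phi =
       distdiv Omega (uc - u0) phi)
    (hbc : boundary_condition b Omega
       (uc - u0 - mxapp (invmx S) (wgrad Omega lam)) lam)
    (hp : p = - (uc - u0 - mxapp (invmx S) (wgrad Omega lam)))
    (hp0 : ~ ae_eqv Omega p 0) :
  let f := fun t : R => J Omega S u0 (uc + t *: p) in
  let Spp := ip Omega (mxapp S p) p in
  [/\ forall t : R, f t = J Omega S u0 uc - t * Spp + t ^+ 2 / 2 * Spp,
      unique_minimizer f 1,
      adjusted_field Omega S u0 uc p =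
        u0 + mxapp (invmx S) (wgrad Omega lam) &
      ae_eqv Omega uc 0 ->
        [/\ adjusted_field Omega S u0 uc p =
              u0 + mxapp (invmx S) (wgrad Omega lam),
            forall phi, test_function Omega phi ->
              distdiv Omega (mxapp (invmx S) (wgrad Omega lam)) phi =
              - distdiv Omega u0 phi &
            boundary_condition b Omega
              (u0 + mxapp (invmx S) (wgrad Omega lam)) lam]].
Proof.
move=> f Spp.
have [_ oO _ bO _] := hOmega.
have mO := open_measurable3 _ _ oO.
have Llam := L2v_wgrad _ _ hlam.1.
set q := mxapp (invmx S) (wgrad Omega lam) in heq hbc hp *.
have Lq : L2v Omega q by exact: L2v_mxapp.
have Luc := huc.1.
have Lw : L2v Omega (uc - u0) by exact: L2vB.
have Lh : L2v Omega (uc - u0 - q) by exact: L2vB.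
have Lp : L2v Omega p by rewrite hp; exact: L2vN.
have LSp : L2v Omega (mxapp S p) by exact: L2v_mxapp.
have orth : ip Omega (wgrad Omega lam) p = 0.
  rewrite hp ipC ipNl// ipC (wgrad_orthogonal _ oO bO b)//; first exact: oppr0.
    exact: hlam.1.
  by move=> phi tphi; rewrite distdivB// heq// subrr.
have Sq : mxapp S (uc - u0) = - mxapp S p + wgrad Omega lam.
  apply/funext => x; rewrite hp.
  transitivity (- (S *m - (uc x - u0 x - q x)) + wgrad Omega lam x) => //.
  rewrite mulmxN opprK [in RHS]mulmxBr /q /mxapp mulKVmx ?posdef_unitmx//.
  by rewrite subrK.
have cross : ip Omega (mxapp S (uc - u0)) p = - Spp.
  by rewrite Sq ipDl ?ipNl// ?orth ?addr0//; exact: L2vN.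
have fE t : f t = J Omega S u0 uc - t * Spp + t ^+ 2 / 2 * Spp.
  by rewrite /f J_line ?hS.1// cross mulrN.
have Spp0 : 0 < Spp by exact: ip_posdef_gt0.
have min1 := quadratic_unique_minimizer _ _ _ Spp0 fE.
have t1 : step_length Omega S u0 uc p = 1.
  have : unique_minimizer f (step_length Omega S u0 uc p).
    by apply: (@xgetPex _ 0 [set t | unique_minimizer f t]); exists 1.
  by move=> [/min1.2].
have adj : adjusted_field Omega S u0 uc p = u0 + q.
  rewrite /adjusted_field t1 scale1r hp.
  by rewrite !opprB addrCA (addrC uc) subrK addrC.
split => // uc0; split => //.
- move=> phi tphi; rewrite heq// distdivB//.
  rewrite /distdiv [in X in - X - _]ip_ae0//; last exact: L2v_grad.
  by rewrite oppr0 sub0r.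
- move: b hbc => [|//] hbc.
  apply: zero_normal_trace_ae_opp hbc => //; first exact: L2vD.
  by rewrite -[uc - u0 - q]addrA -opprD subrK.
Qed.
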